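(* Consider the port-Hamiltonian DAE model described in the context, including the constant-core index-one assumption. Let $k\in\{1,2\}$, $\alpha_1=1$, $\alpha_2=\frac32$, and assume $M_{dd}>0$. Then the matrix $\frac{\alpha_k}{\delta t}E+A$ is invertible for every $\delta t>0$. Consequently, the primal step $$\frac{\alpha_kE\bar x^{\ell+1}-A_k[Ex^\ell]}{\delta t}+A\bar x^{\ell+1}+g(G_k[x^\ell])=BC_k[\bar u^{\ell+1}]$$ admits a unique solution $\bar x^{\ell+1}$ for every $\ell$, with a system matrix (hence a matrix factorization) that is constant across all time steps for fixed $k$ and $\delta t$.
   Context: **Model.** $T>0$ is a final time. $E,Q\in\mathbb R^{n\times n}$, $B\in\mathbb R^{n\times m}$ satisfy $Q=Q^\top\ge0$, $E^\top Q=Q^\top E\ge0$. For every $x\in\mathbb R^n$, $J(x)=-J(x)^\top$ and $R(x)=R(x)^\top\ge0$ in $\mathbb R^{n\times n}$. $e:\mathbb R^n\to\mathbb R^n$ is the effort map and $H:\mathbb R^n\to\mathbb R$ the Hamiltonian, with $E^\top e(x)=\nabla H(x)$; there is $C>0$ with $H(x)>-C$ for all $x$. The input satisfies $u\in C^2([0,T],\mathbb R^m)$. The function $x:[0,T]\to\mathbb R^n$ is an exact solution of $$\tfrac{\mathrm d(Ex)}{\mathrm dt}=(J(x)-R(x))e(x)+Bu(t),\qquad y=B^\top e(x),$$ with $Ex\in C^3([0,T])$, $x\in C^2([0,T])$, and consistent initial value $x(0)=x_0$ (there is $v_0$ with $Ev_0=(J(x_0)-R(x_0))e(x_0)+Bu(0)$);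 the pencil $(E,\check A(x))$, with $\check A(x)$ the Jacobian of the right-hand side, is regular and of index one along $x$. **Splitting.** $e(x)=Qx+e_{\mathrm{nl}}(x)$, $J(x)=J_0+J_1(x)$, $R(x)=R_0+R_1(x)$ with $J_0,J_1(x)$ skew-symmetric and $R_0=R_0^\top\ge0$. Set $A:=-(J_0-R_0)Q$, $g(x):=-(J_0-R_0)e_{\mathrm{nl}}(x)-(J_1(x)-R_1(x))e(x)$. Constant-core index-one assumption: the pencil $(E,A)$ is regular and of index one. **Index-one form.** Fix nonsingular $S,V\in\mathbb R^{n\times n}$ with $SEV=\begin{pmatrix}I_d&0\\0&0\end{pmatrix}$, $SAV=\begin{pmatrix}\tilde A_{11}&\tilde A_{12}\\\tilde A_{21}&\tilde A_{22}\end{pmatrix}$, $\tilde A_{22}$ nonsingular. $P_d:=V\begin{pmatrix}I_d\\0\end{pmatrix}$, $M_{dd}:=P_d^\top E^\top QP_d\in\mathbb R^{d\times d}$. **BDF quantities.** $t^\ell=\ell\,\delta t$, $\bar u^{\ell+1}:=\frac1{\delta t}\int_{t^\ell}^{t^{\ell+1}}u(s)\,\mathrm ds$. For $k=1$: $A_1[Ex^\ell]=Ex^\ell$, $G_1[x^\ell]=x^\ell$, $C_1[\bar u^{\ell+1}]=\bar u^{\ell+1}$. For $k=2$: $A_2[Ex^\ell]=2Ex^\ell-\frac12Ex^{\ell-1}$, $G_2[x^\ell]=2x^\ell-x^{\ell-1}$, $C_2[\bar u^{\ell+1}]=\frac32\bar u^{\ell+1}-\frac12\bar u^\ell$. The history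 states $x^\ell$ (and $x^{\ell-1}$ for $k=2$) are given. *)

(* Defs.v *)
From HB Require Import structures.
From mathcomp Require Import all_boot all_order all_algebra perm.
From mathcomp Require Import all_classical all_reals all_analysis.

Set Implicit Arguments.
Unset Strict Implicit.
Unset Printing Implicit Defensive.

Import Order.TTheory GRing.Theory Num.Theory.
Import numFieldNormedType.Exports.
Local Open Scope classical_set_scope.
Local Open Scope ring_scope.

Section Matrices.
Variable R : realType.

Definition skewmx n (M : 'M[R]_n) : Prop := M^T = - M.

Definition psdmx n (M : 'M[R]_n) : Prop :=
  M^T = M /\ forall v : 'cV[R]_n, 0 <= (v^T *m M *m v) 0 0.

Definition pdmx n (M : 'M[R]_n) : Prop :=
  M^T = M /\ forall v : 'cV[R]_n, v != 0 -> 0 < (v^T *m M *m v) 0 0.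

(* Regularity and index of (E, A) do not depend on whether the pencil is read
   as s E - A or s E + A. *)
Definition pencil_regular n (E A : 'M[R]_n) : Prop :=
  \det ('X *: map_mx polyC E - map_mx polyC A) != 0.

(* Kronecker index: the nilpotency index of the nilpotent block N of a
   Weierstrass canonical form of (E, A). It is 0 when E is nonsingular (the
   block N is then 0 x 0), and 1 when N = 0 is a nonempty block. *)
Definition pencil_index n (E A : 'M[R]_n) (nu : nat) : Prop :=
  exists (d r : nat) (dr : (d + r)%N = n) (S V : 'M[R]_n)
         (C : 'M[R]_d) (N : 'M[R]_r),
    [/\ S \in unitmx, V \in unitmx,
        S *m E *m V = castmx (dr, dr) (block_mx 1%:M 0 0 N),
        S *m A *m V = castmx (dr, dr) (block_mx C 0 0 1%:M)
      & N ^+ nu = 0 /\ forall mu, (mu < nu)%N -> N ^+ mu <> 0].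

End Matrices.

Section Calculus.
Variable R : realType.

Definition gradient n (H : 'cV[R]_n -> R) (x : 'cV[R]_n) : 'cV[R]_n :=
  \col_i 'd (H : 'cV[R]_n -> R^o) x (delta_mx i 0).

(* [jacobian] in the library is for maps between row vectors. *)
Definition col_jacobian n p (f : 'cV[R]_n -> 'cV[R]_p) (x : 'cV[R]_n) :
    'M[R]_(p, n) :=
  \matrix_(i, j) ('d f x (delta_mx j 0)) i 0.

(* Difference quotients are taken inside [0, T], so the derivative is one-sided
   at the end points and values of f outside [0, T] are irrelevant. *)
Definition has_deriv_on (V : normedModType R) (T : R) (f f' : R -> V) : Prop :=
  forall t : R, t \in `[0, T] ->
    (fun s => (s - t)^-1 *: (f s - f t)) @ within `[0, T] (dnbhs t) --> f' t.

Fixpoint Ck_on (V : normedModType R) (k : nat) (T : R) (f : R -> V) : Prop :=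
  if k is k'.+1 then exists f', has_deriv_on T f f' /\ Ck_on k' T f'
  else {within `[0, T], continuous f}.

End Calculus.

Section Model.
Variables (R : realType) (n m : nat).

Record port_hamiltonian (E Q : 'M[R]_n) (J D : 'cV[R]_n -> 'M[R]_n)
    (e : 'cV[R]_n -> 'cV[R]_n) (H : 'cV[R]_n -> R) : Prop := PortHamiltonian {
  ph_Q_psd : psdmx Q;
  ph_EQ_sym : E^T *m Q = Q^T *m E;
  ph_EQ_psd : psdmx (E^T *m Q);
  ph_J_skew : forall x, skewmx (J x);
  ph_D_psd : forall x, psdmx (D x);
  ph_H_diff : forall x, differentiable (H : 'cV[R]_n -> R^o) x;
  ph_H_grad : forall x, E^T *m e x = gradient H x;
  ph_H_bounded : exists2 C : R, 0 < C & forall x, H x > - C }.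

Definition ph_rhs (B : 'M[R]_(n, m)) (J D : 'cV[R]_n -> 'M[R]_n)
    (e : 'cV[R]_n -> 'cV[R]_n) (u : R -> 'cV[R]_m) (t : R) (x : 'cV[R]_n) :
    'cV[R]_n :=
  (J x - D x) *m e x + B *m u t.

(* The differentiability clause makes the Jacobian of the last clause
   meaningful, as ['d] is a total operator. *)
Record exact_solution (T : R) (E : 'M[R]_n) (B : 'M[R]_(n, m))
    (J D : 'cV[R]_n -> 'M[R]_n) (e : 'cV[R]_n -> 'cV[R]_n)
    (u : R -> 'cV[R]_m) (x0 : 'cV[R]_n) (x : R -> 'cV[R]_n)
    (y : R -> 'cV[R]_m) : Prop := ExactSolution {
  sol_Ex_C3 : Ck_on 3 T (fun t => E *m x t);
  sol_x_C2 : Ck_on 2 T x;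
  sol_dae : has_deriv_on T (fun t => E *m x t)
              (fun t => ph_rhs B J D e u t (x t));
  sol_output : forall t, t \in `[0, T] -> y t = B^T *m e (x t);
  sol_init : x 0 = x0;
  sol_consistent : exists v0, E *m v0 = ph_rhs B J D e u 0 x0;
  sol_rhs_diff : forall t, t \in `[0, T] ->
    differentiable (ph_rhs B J D e u t) (x t);
  sol_index1 : forall t, t \in `[0, T] ->
    let A := col_jacobian (ph_rhs B J D e u t) (x t) in
    pencil_regular E A /\ pencil_index E A 1 }.

Record core_splitting (Q : 'M[R]_n) (J D : 'cV[R]_n -> 'M[R]_n)
    (e : 'cV[R]_n -> 'cV[R]_n) (J0 D0 : 'M[R]_n)
    (J1 D1 : 'cV[R]_n -> 'M[R]_n) (enl : 'cV[R]_n -> 'cV[R]_n) : Prop :=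
    CoreSplitting {
  split_e : forall x, e x = Q *m x + enl x;
  split_J : forall x, J x = J0 + J1 x;
  split_D : forall x, D x = D0 + D1 x;
  split_J0_skew : skewmx J0;
  split_J1_skew : forall x, skewmx (J1 x);
  split_D0_psd : psdmx D0 }.

Definition core_mx (Q J0 D0 : 'M[R]_n) : 'M[R]_n := - (J0 - D0) *m Q.

Definition core_nl (e : 'cV[R]_n -> 'cV[R]_n) (J0 D0 : 'M[R]_n)
    (J1 D1 : 'cV[R]_n -> 'M[R]_n) (enl : 'cV[R]_n -> 'cV[R]_n)
    (x : 'cV[R]_n) : 'cV[R]_n :=
  - (J0 - D0) *m enl x - (J1 x - D1 x) *m e x.

Definition index_one_form (E A : 'M[R]_n) (d r : nat) (dr : (d + r)%N = n)
    (S V : 'M[R]_n) (A11 : 'M[R]_d) (A12 : 'M[R]_(d, r))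
    (A21 : 'M[R]_(r, d)) (A22 : 'M[R]_r) : Prop :=
  [/\ S \in unitmx, V \in unitmx,
      S *m E *m V = castmx (dr, dr) (block_mx 1%:M 0 0 0),
      S *m A *m V = castmx (dr, dr) (block_mx A11 A12 A21 A22)
    & A22 \in unitmx].

Definition Pd_mx (d r : nat) (dr : (d + r)%N = n) (V : 'M[R]_n) :
    'M[R]_(n, d) :=
  V *m castmx (dr, erefl d) (col_mx 1%:M 0).

Definition Mdd_mx (E Q : 'M[R]_n) (d r : nat) (dr : (d + r)%N = n)
    (V : 'M[R]_n) : 'M[R]_d :=
  (Pd_mx dr V)^T *m E^T *m Q *m Pd_mx dr V.

End Model.

(* The order k is only meant to be 1 or 2; other orders get dummy values. For
   k = 2 the operators at time level l involve level l.-1, so l >= 1 is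
   required there. *)
Section BDF.
Variable R : realType.

Definition bdf_alpha (k : nat) : R :=
  match k with 1 => 1 | 2 => 3%:R / 2%:R | _ => 0 end.

Definition bdf_hist p (k : nat) (w : nat -> 'cV[R]_p) (l : nat) : 'cV[R]_p :=
  match k with
  | 1 => w l
  | 2 => 2%:R *: w l - 2%:R^-1 *: w l.-1
  | _ => 0
  end.

Definition bdf_extrap p (k : nat) (w : nat -> 'cV[R]_p) (l : nat) :
    'cV[R]_p :=
  match k with 1 => w l | 2 => 2%:R *: w l - w l.-1 | _ => 0 end.

(* C_k[ubar^(l+1)] *)
Definition bdf_input p (k : nat) (ubar : nat -> 'cV[R]_p) (l : nat) :
    'cV[R]_p :=
  match k with
  | 1 => ubar l.+1
  | 2 => (3%:R / 2%:R) *: ubar l.+1 - 2%:R^-1 *: ubar l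
  | _ => 0
  end.

Definition time_grid (dt : R) (l : nat) : R := l%:R * dt.

(* ubar^j, the mean of u over [t^(j-1), t^j], for j >= 1 *)
Definition mean_input p (dt : R) (u : R -> 'cV[R]_p) (j : nat) : 'cV[R]_p :=
  \col_i (dt^-1 * \int[lebesgue_measure]_(s in
                     `[time_grid dt j.-1, time_grid dt j]) u s i 0).

(* The step from t^l to t^(l+1) lies in [0, T] and has its k history states. *)
Definition admissible_step (T : R) (k : nat) (dt : R) (l : nat) : Prop :=
  (k <= l.+1)%N /\ time_grid dt l.+1 <= T.

Definition step_mx n (k : nat) (dt : R) (E A : 'M[R]_n) : 'M[R]_n :=
  (bdf_alpha k / dt) *: E + A.

Definition step_lhs n (k : nat) (dt : R) (E A : 'M[R]_n)
    (g : 'cV[R]_n -> 'cV[R]_n) (X : nat -> 'cV[R]_n) (l : nat)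
    (z : 'cV[R]_n) : 'cV[R]_n :=
  dt^-1 *: (bdf_alpha k *: (E *m z) - bdf_hist k (fun j => E *m X j) l)
  + A *m z + g (bdf_extrap k X l).

Definition primal_step n m (k : nat) (dt : R) (E A : 'M[R]_n)
    (g : 'cV[R]_n -> 'cV[R]_n) (B : 'M[R]_(n, m)) (u : R -> 'cV[R]_m)
    (X : nat -> 'cV[R]_n) (l : nat) (z : 'cV[R]_n) : Prop :=
  step_lhs k dt E A g X l z = B *m bdf_input k (mean_input dt u) l.

(* F is affine with linear part M; such an M is unique. *)
Definition has_system_mx n (F : 'cV[R]_n -> 'cV[R]_n) (M : 'M[R]_n) : Prop :=
  exists b, forall z, F z = M *m z + b.

End BDF.

(* Main.v *)
Require Import Defs.
From HB Require Import structures.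
From mathcomp Require Import all_boot all_order all_algebra perm.
From mathcomp Require Import all_classical all_reals all_analysis.

Set Implicit Arguments.
Unset Strict Implicit.
Unset Printing Implicit Defensive.

Import Order.TTheory GRing.Theory Num.Theory.
Import numFieldNormedType.Exports.
Local Open Scope classical_set_scope.
Local Open Scope ring_scope.

(** Multiply a kernel vector z of c E + A, with c > 0, on the left by (Q z)^T.
    The skew part J0 does no work, so what remains is
      c * z^T E^T Q z + (Q z)^T D0 (Q z) = 0,
    a sum of two nonnegative terms; hence the energy z^T E^T Q z vanishes.
    In the coordinates w = V^-1 z of the index-one form, E only sees the
    differential block w_1, and because E^T Q is symmetric the energy is the
    quadratic form w_1^T M_dd w_1. Definiteness of M_dd forces w_1 = 0, so
    E z = 0 and therefore A z = 0. The algebraic rows of the last equation read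
    A_22 w_2 = 0, and index one (A_22 nonsingular) gives w_2 = 0. This is
    [core_pencil_unitmx].

    The nonlinearity and the history enter a step only through known states,
    so the residual of a step is affine in the new state with linear part
    (alpha_k / dt) E + A ([step_lhs_affine]). This matrix does not mention the
    step, so that one factorization of it ([PLU_exists]) serves all steps, and
    its invertibility gives a unique solution of each step. *)

Section LinearAlgebra.
Variable R : realType.

Lemma skewmx_qform n (M : 'M[R]_n) (v : 'cV[R]_n) :
  Defs.skewmx M -> (v^T *m M *m v) 0 0 = 0.
Proof.
move=> skewM; set a := _ 0 0.
(* A 1 x 1 matrix is its own transpose, while skewness makes this transpose
   the opposite of the matrix. *)
have aN : a = - a.
  rewrite {1}/a -[in LHS](trmxK (v^T *m M *m v)) mxE.
  by rewrite !trmx_mul trmxK skewM mulNmx mulmxN mulmxA mxE.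
have : a *+ 2 == 0 by rewrite mulr2n {2}aN subrr.
by rewrite mulrn_eq0 => /eqP.
Qed.

Lemma unitmx_ker0 (F : fieldType) n (M : 'M[F]_n) :
  (forall z : 'cV[F]_n, M *m z = 0 -> z = 0) -> M \in unitmx.
Proof.
move=> kerM; rewrite -unitmx_tr -row_free_unit -kermx_eq0.
apply/rowV0P => v /sub_kermxP vM.
apply: trmx_inj; rewrite trmx0; apply: kerM.
by rewrite -[M]trmxK -trmx_mul vM trmx0.
Qed.

(** LUP elimination starts from a pivot in the first column, hence the separate
    case of dimension 0, where all matrices are equal. *)
Lemma PLU_exists (F : fieldType) n (M : 'M[F]_n) :
  exists (s : 'S_n) (L U : 'M[F]_n),
    [/\ is_trig_mx L, is_trig_mx U^T & perm_mx s *m L *m U = M].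
Proof.
case: n M => [|n] M.
  exists 1%g, 0, 0; split; [by apply/is_trig_mxP => -[]..|].
  by apply/matrixP => -[].
have := cormen_lup_correct M; have := cormen_lup_perm M.
have := cormen_lup_lower M; have := cormen_lup_upper M.
case: (cormen_lup M) => -[P L] U /= upU lowL /is_perm_mxP[s ->] PM.
exists s^-1%g, L, U; split.
- by apply/is_trig_mxP => i j ij; rewrite lowL ?(ltnW ij)// -val_eqE (ltn_eqF ij).
- by apply/is_trig_mxP => i j ij; rewrite mxE upU.
- by rewrite -mulmxA -[L *m U]PM mulmxA -perm_mxM mulVg perm_mx1 mul1mx.
Qed.

(** A vector without differential part lies in the kernel of E, and index one
    says that the algebraic rows of A still determine such a vector: on it they
    reduce to A_22, which is nonsingular. *)
Lemma index_one_algebraic_ker0 d r (E A S V : 'M[R]_(d + r))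
    (A11 : 'M[R]_d) (A12 : 'M[R]_(d, r)) (A21 : 'M[R]_(r, d)) (A22 : 'M[R]_r)
    (w2 : 'cV[R]_r) :
  index_one_form E A erefl S V A11 A12 A21 A22 ->
  A *m (V *m col_mx 0 w2) = 0 -> w2 = 0.
Proof.
case=> _ _ _; rewrite castmx_id => SAV uA22 Aw.
have : S *m A *m V *m col_mx 0 w2 = 0 by rewrite -!mulmxA Aw mulmx0.
rewrite SAV mul_block_col !mulmx0 !add0r -col_mx0 => /eq_col_mx[_ A22w].
by rewrite -[w2](mulKmx uA22) A22w mulmx0.
Qed.

End LinearAlgebra.

Section CorePencil.
Variable R : realType.

Lemma core_pencil_unitmx n (E Q J0 D0 : 'M[R]_n)
    (d r : nat) (dr : (d + r)%N = n) (S V : 'M[R]_n)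
    (A11 : 'M[R]_d) (A12 : 'M[R]_(d, r)) (A21 : 'M[R]_(r, d)) (A22 : 'M[R]_r)
    (c : R) :
  E^T *m Q = Q^T *m E -> psdmx (E^T *m Q) -> Defs.skewmx J0 -> psdmx D0 ->
  index_one_form E (core_mx Q J0 D0) dr S V A11 A12 A21 A22 ->
  pdmx (Mdd_mx E Q dr V) -> 0 < c ->
  c *: E + core_mx Q J0 D0 \in unitmx.
Proof.
subst n => EQ [_ EQ_ge0] skewJ [_ D_ge0] ixf [_ Mdd_gt0] c_gt0.
have [uS uV SEV _ _] := ixf; rewrite castmx_id in SEV.
apply: unitmx_ker0 => z Mz.
have energy0 : (z^T *m (E^T *m Q) *m z) 0 0 = 0.
  have : ((Q *m z)^T *m ((c *: E + core_mx Q J0 D0) *m z)) 0 0 = 0.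
    by rewrite Mz mulmx0 mxE.
  have -> : (Q *m z)^T *m ((c *: E + core_mx Q J0 D0) *m z) =
      c *: (z^T *m (E^T *m Q) *m z) - (Q *m z)^T *m J0 *m (Q *m z)
      + (Q *m z)^T *m D0 *m (Q *m z).
    rewrite EQ /core_mx !(mulmxDl, mulmxDr, mulNmx, mulmxN, trmx_mul) opprD opprK.
    by rewrite -scalemxAl -scalemxAr !mulmxA addrA.
  rewrite mxE [X in X + _]mxE [X in X + _ + _]mxE [X in _ + X + _]mxE.
  rewrite (skewmx_qform _ skewJ) subr0.
  have := D_ge0 (Q *m z); have := EQ_ge0 z.
  set a := fun_of_matrix (z^T *m (E^T *m Q) *m z) 0 0.
  set b := fun_of_matrix ((Q *m z)^T *m D0 *m (Q *m z)) 0 0.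
  move=> a_ge0 b_ge0 /eqP.
  rewrite (paddr_eq0 (mulr_ge0 (ltW c_gt0) a_ge0) b_ge0) => /andP[+ _].
  by rewrite mulf_eq0 gt_eqF//= => /eqP.
pose w := invmx V *m z.
have zE : z = V *m w by rewrite mulKVmx.
set w1 := usubmx w; set w2 := dsubmx w.
have wE : w = col_mx w1 w2 by rewrite vsubmxK.
have Pd1 : Pd_mx erefl V *m w1 = V *m col_mx w1 0.
  by rewrite /Pd_mx castmx_id -mulmxA mul_col_mx mul1mx mul0mx.
have EzE : E *m z = E *m (Pd_mx erefl V *m w1).
  rewrite Pd1 zE wE; apply: (can_inj (mulKmx uS)).
  by rewrite !mulmxA SEV !mul_block_col !mul0mx !addr0.
have w1_0 : w1 = 0.
  apply/eqP/negP => /negP /Mdd_gt0; rewrite -energy0.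
  have -> : z^T *m (E^T *m Q) *m z = w1^T *m Mdd_mx E Q erefl V *m w1.
    set p := Pd_mx erefl V *m w1 in EzE *.
    have Ez_left : z^T *m (E^T *m Q) = p^T *m (E^T *m Q).
      by rewrite !mulmxA -!trmx_mul EzE.
    (* The symmetry of E^T Q brings E next to the right copy of z. *)
    have Ez_right : E^T *m Q *m z = E^T *m Q *m p.
      by rewrite EQ -!mulmxA EzE.
    by rewrite Ez_left -[LHS]mulmxA Ez_right /Mdd_mx trmx_mul !mulmxA.
  by rewrite ltxx.
have Ez0 : E *m z = 0 by rewrite EzE w1_0 !mulmx0.
have Az0 : core_mx Q J0 D0 *m z = 0.
  by move: Mz; rewrite mulmxDl -scalemxAl Ez0 scaler0 add0r.
have w2_0 : w2 = 0 by apply: (index_one_algebraic_ker0 ixf); rewrite -w1_0 -wE -zE.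
by rewrite zE wE w1_0 w2_0 col_mx0 mulmx0.
Qed.

Lemma step_lhs_affine n (k : nat) (dt : R) (E A : 'M[R]_n)
    (g : 'cV[R]_n -> 'cV[R]_n) (X : nat -> 'cV[R]_n) (l : nat) :
  has_system_mx (step_lhs k dt E A g X l) (step_mx k dt E A).
Proof.
exists (- (dt^-1 *: bdf_hist k (fun j => E *m X j) l)
        + g (bdf_extrap k X l)) => z.
rewrite /step_lhs /step_mx mulmxDl -scalemxAl scalerBr scalerA.
by rewrite (mulrC dt^-1) addrA; congr (_ + _); rewrite addrAC.
Qed.

Lemma has_system_mx_exists_unique n (F : 'cV[R]_n -> 'cV[R]_n) (M : 'M[R]_n)
    (f : 'cV[R]_n) :
  has_system_mx F M -> M \in unitmx -> exists! z, F z = f.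
Proof.
move=> [b FE] uM; exists (invmx M *m (f - b)); split.
  by rewrite FE mulKVmx// subrK.
by move=> z <-; rewrite FE addrK mulKmx.
Qed.

End CorePencil.

Theorem proposition3p4 (R : realType) (n m : nat) (T : R)
  (E Q : 'M[R]_n) (B : 'M[R]_(n, m)) (J D : 'cV[R]_n -> 'M[R]_n)
  (e : 'cV[R]_n -> 'cV[R]_n) (H : 'cV[R]_n -> R)
  (u : R -> 'cV[R]_m) (x0 : 'cV[R]_n)
  (x : R -> 'cV[R]_n) (y : R -> 'cV[R]_m)
  (J0 D0 : 'M[R]_n) (J1 D1 : 'cV[R]_n -> 'M[R]_n)
  (enl : 'cV[R]_n -> 'cV[R]_n)
  (d r : nat) (dr : (d + r)%N = n) (S V : 'M[R]_n)
  (A11 : 'M[R]_d) (A12 : 'M[R]_(d, r)) (A21 : 'M[R]_(r, d)) (A22 : 'M[R]_r)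
  (k : nat) :
  let A := core_mx Q J0 D0 in
  let g := core_nl e J0 D0 J1 D1 enl in
  0 < T ->
  port_hamiltonian E Q J D e H ->
  Ck_on 2 T u ->
  exact_solution T E B J D e u x0 x y ->
  core_splitting Q J D e J0 D0 J1 D1 enl ->
  pencil_regular E A /\ pencil_index E A 1 ->
  index_one_form E A dr S V A11 A12 A21 A22 ->
  k = 1%N \/ k = 2%N ->
  pdmx (Mdd_mx E Q dr V) ->
  forall dt : R, 0 < dt ->
  [/\
      step_mx k dt E A \in unitmx,
      forall (X : nat -> 'cV[R]_n) (l : nat), admissible_step T k dt l ->
        exists! z : 'cV[R]_n, primal_step k dt E A g B u X l z,
      forall (X : nat -> 'cV[R]_n) (l : nat), admissible_step T k dt l ->
        has_system_mx (step_lhs k dt E A g X l) (step_mx k dt E A)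
    &
      exists (s : 'S_n) (L U : 'M[R]_n),
        [/\ is_trig_mx L, is_trig_mx U^T
          & forall (X : nat -> 'cV[R]_n) (l : nat),
              admissible_step T k dt l ->
              has_system_mx (step_lhs k dt E A g X l)
                            (perm_mx s *m L *m U)]].
Proof.
move=> A g _ [_ EQ EQ_psd _ _ _ _ _] _ _ [_ _ _ skewJ0 _ D0_psd] _ ixf k12 Mdd.
move=> dt dt_gt0.
have alpha_gt0 : 0 < bdf_alpha R k.
  by case: k12 => -> /=; rewrite ?ltr01 ?divr_gt0 ?ltr0n.
have uM : step_mx k dt E A \in unitmx.
  exact: (core_pencil_unitmx EQ EQ_psd skewJ0 D0_psd ixf Mdd
            (divr_gt0 alpha_gt0 dt_gt0)).
split=> //.
- move=> X l _.
  exact: has_system_mx_exists_unique (step_lhs_affine _ _ _ _ _ _ _) uM.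
- by move=> X l _; exact: step_lhs_affine.
- have [s [L [U [trigL trigU PLU]]]] := PLU_exists (step_mx k dt E A).
  by exists s, L, U; split=> // X l _; rewrite PLU; exact: step_lhs_affine.
Qed.
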